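(* Let $G$ be a finite group with $|G|=2^{r'}$ and let $U:g\mapsto U_g$ be a unitary representation of $G$ on $\mathbb{C}^2$. Associate to each element $g\in G$ a distinct computational basis vector $|g\rangle$ of $(\mathbb{C}^2)^{\otimes r'}$. For a positive integer $m$ let $$W=\sum_{g\in G}|g\rangle\langle g|\otimes U_g^{\otimes m},$$ a unitary operator on $r'+m$ qubits, which satisfies $$W\left(|+\rangle^{\otimes r'}\otimes|\phi\rangle\right)=\frac{1}{\sqrt{|G|}}\sum_{g\in G}|g\rangle\otimes U_g^{\otimes m}|\phi\rangle$$ for every $|\phi\rangle\in(\mathbb{C}^2)^{\otimes m}$, where $|+\rangle=(|0\rangle+|1\rangle)/\sqrt2$. Then $W$ can be implemented by a quantum circuit in which the total number of elementary gates is $$|G|\,(41r'-80+m),$$ and whose logical depth is $$|G|\,(41r'-80+1).$$ In particular, the number of gates is linear in $m$ and scales with the group order as $|G|\log|G|$, and the logical depth is independent of $m$.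
   Context: Elementary gates are single-qubit and two-qubit unitary gates. The circuit may use an auxiliary qubit prepared in $|0\rangle$. The logical depth of a circuit is the number of time steps it requires; here the $m$ controlled-$U_g$ gates that share the same control qubit and act on the $m$ different target qubits are counted as being implemented in parallel, i.e. as one time step.
   Formalization: The formal theorem assumes r' ≥ 2; for r' = 0 and r' = 1 the claimed logical depth |G|(41r'-80+1) is negative (-79 and -76), so the statement as written cannot hold there. *)

(* Defs.v *)
From HB Require Import structures.
From mathcomp Require Import all_boot all_order all_algebra all_fingroup all_character.
From mathcomp Require Import complex reals.
Set Implicit Arguments.
Unset Strict Implicit.
Unset Printing Implicit Defensive.
Import Order.TTheory GRing.Theory Num.Theory.
Local Open Scope ring_scope.
Local Open Scope sesquilinear_scope.

(* Computational basis labels of n qubits.  The space of n qubits has the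
   basis indexed by [bits n]; vectors and operators are library matrices over
   the enumeration of [bits n], read through [enum_rank]. *)
Definition bits (n : nat) := {ffun 'I_n -> bool}.

Notation qstate C n := 'cV[C]_#|{: bits n}|.
Notation qop C n := 'M[C]_#|{: bits n}|.

Section Qubits.
Variable C : numClosedFieldType.

Definition amp n (v : qstate C n) (x : bits n) : C := v (enum_rank x) 0.

Definition entry n (A : qop C n) (x y : bits n) : C :=
  A (enum_rank x) (enum_rank y).

Definition mkstate n (f : bits n -> C) : qstate C n :=
  \col_i f (enum_val i).

Definition mkop n (f : bits n -> bits n -> C) : qop C n :=
  \matrix_(i, j) f (enum_val i) (enum_val j).

Definition ket n (x : bits n) : qstate C n := mkstate (fun y => (y == x)%:R).

Definition ketbra n (x : bits n) : qop C n := ket x *m (ket x) ^t*.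

Definition lbits a b (x : bits (a + b)) : bits a := [ffun i => x (lshift b i)].
Definition rbits a b (x : bits (a + b)) : bits b := [ffun i => x (rshift a i)].

Definition tens_state a b (v : qstate C a) (w : qstate C b) : qstate C (a + b) :=
  mkstate (fun x => amp v (lbits x) * amp w (rbits x)).

Definition tens_op a b (A : qop C a) (B : qop C b) : qop C (a + b) :=
  mkop (fun x y => entry A (lbits x) (lbits y) * entry B (rbits x) (rbits y)).

(* The basis |0>, |1> of C^2 is indexed by 0, 1 : 'I_2. *)
Definition bit2ord (b : bool) : 'I_2 := if b then 1 else 0.

Definition tpow_state n (v : 'cV[C]_2) : qstate C n :=
  mkstate (fun x => \prod_(k < n) v (bit2ord (x k)) 0).

Definition tpow_op n (A : 'M[C]_2) : qop C n :=
  mkop (fun x y => \prod_(k < n) A (bit2ord (x k)) (bit2ord (y k))).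

Definition plus_state : 'cV[C]_2 := (sqrtC 2)^-1 *: (delta_mx 0 0 + delta_mx 1 0).

Section Circuits.
Variable n : nat.

(* [gate_mat] acts on the qubits [gate_pos 0], [gate_pos 1], ... in this order *)
Record gate := Gate {
  gate_arity : nat;
  gate_mat : qop C gate_arity;
  gate_pos : {ffun 'I_gate_arity -> 'I_n} }.

Definition elementary (g : gate) : bool :=
  [&& (gate_arity g == 1%N) || (gate_arity g == 2%N),
      injectiveb (gate_pos g) & gate_mat g \is unitarymx].

Definition gate_op (g : gate) : qop C n :=
  mkop (fun x y =>
    entry (gate_mat g) [ffun i => x (gate_pos g i)] [ffun i => y (gate_pos g i)]
    * [forall k, (k \notin codom (gate_pos g)) ==> (x k == y k)]%:R).

Definition gates_disjoint (g h : gate) : bool :=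
  [disjoint codom (gate_pos g) & codom (gate_pos h)].

(* |0><0| (x) 1 + |1><1| (x) A; qubit 0 is the control *)
Definition ctrl_op (A : 'M[C]_2) : qop C (1 + 1) :=
  tens_op (ketbra ([ffun=> false] : bits 1)) (1%:M : qop C 1)
  + tens_op (ketbra ([ffun=> true] : bits 1)) (tpow_op 1 A).

Definition ctrl_gate (A : 'M[C]_2) (c t : 'I_n) : gate :=
  @Gate 2 (ctrl_op A) [ffun i : 'I_2 => if i == 0 then c else t].

(* A circuit is the list of its time steps, each being the list of the gates
   applied during that step; the first step acts first. *)
Definition circuit := seq (seq gate).

(* A time step consists either of gates on pairwise disjoint sets of qubits, or
   of the m controlled-(U g) gates, for a single g, that share the control c and
   act on the m qubits [target k]. *)
Definition time_step (gT : finGroupType) (G : {group gT}) (U : gT -> 'M[C]_2)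
    (m : nat) (target : 'I_m -> 'I_n) (s : seq gate) : Prop :=
  [/\ (0 < size s)%N, all elementary s &
      pairwise gates_disjoint s
      \/ exists g c, g \in G
           /\ s = [seq ctrl_gate (U g) c (target k) | k <- enum 'I_m]].

Definition valid_circuit (gT : finGroupType) (G : {group gT})
    (U : gT -> 'M[C]_2) (m : nat) (target : 'I_m -> 'I_n) (c : circuit) : Prop :=
  forall i, (i < size c)%N -> time_step G U target (nth [::] c i).

Definition gate_count (c : circuit) : nat := sumn [seq size s | s <- c].

Definition logical_depth (c : circuit) : nat := size c.

Definition circuit_op (c : circuit) : qop C n :=
  foldl (fun M g => gate_op g *m M) 1%:M (flatten c).

End Circuits.

(* Qubit order of the circuit: r label qubits, m target qubits, then one
   auxiliary qubit, prepared in |0> and returned to |0>. *)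
Definition target_qubit (r m : nat) (k : 'I_m) : 'I_(r + m + 1) :=
  lshift 1 (rshift r k).

Definition implements (n : nat) (c : circuit (n + 1)) (W : qop C n) : Prop :=
  forall psi : qstate C n,
    circuit_op c *m tens_state psi (ket ([ffun=> false] : bits 1))
    = tens_state (W *m psi) (ket ([ffun=> false] : bits 1)).

Definition group_op (gT : finGroupType) (G : {group gT}) (U : gT -> 'M[C]_2)
    (r m : nat) (label : gT -> bits r) : qop C (r + m) :=
  \sum_(g in G) tens_op (ketbra (label g)) (tpow_op m (U g)).

End Qubits.

Arguments group_op {C gT} G U {r} m label.
Arguments target_qubit {r m} k.

(* Main.v *)
Require Import Defs.
From HB Require Import structures.
From mathcomp Require Import all_boot all_order all_algebra all_fingroup all_character.
From mathcomp Require Import complex reals.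
From mathcomp Require Import zify ring.
Import Order.TTheory GRing.Theory Num.Theory.
Set Implicit Arguments.
Unset Strict Implicit.
Unset Printing Implicit Defensive.
Local Open Scope ring_scope.
Local Open Scope sesquilinear_scope.

(** By noncommutative Moebius inversion over the Boolean lattice, the map from a
    label l to the group element it encodes is an ordered product, over all T <= l,
    of suitable elements h_T of G.  Hence W is the product over all bit strings T of
    "apply U_(h_T) to every target when T <= l".  Such a factor costs no extra gate
    for |T| = 0 (uncontrolled) or |T| = 1 (controlled by a label qubit), and 8 gates
    for |T| = 2.  For |T| = k >= 3, the conjunction of k label qubits is written on
    the auxiliary qubit and erased again, each time with at most 8k - 20 Toffoli
    gates, the first target qubit serving as borrowed qubit.  A string of weight k
    and its complement together need at most 2(41r - 80) gates when r >= 3; for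
    r = 2 the total is exactly 8.  Identity gates make up the difference. *)

(** * Operators that act qubit by qubit, and permutations of basis labels *)

Section Operators.
Variable C : numClosedFieldType.
Implicit Types n : nat.

Lemma entry_mkop n (f : bits n -> bits n -> C) x y : entry (mkop f) x y = f x y.
Proof. by rewrite /entry mxE !enum_rankK. Qed.

Lemma amp_mkstate n (f : bits n -> C) x : amp (mkstate f) x = f x.
Proof. by rewrite /amp mxE enum_rankK. Qed.

Lemma opP n (A B : qop C n) : (forall x y, entry A x y = entry B x y) -> A = B.
Proof.
move=> eqAB; apply/matrixP => i j.
by have := eqAB (enum_val i) (enum_val j); rewrite /entry !enum_valK.
Qed.

Lemma stateP n (v w : qstate C n) : (forall x, amp v x = amp w x) -> v = w.
Proof.
move=> eqvw; apply/matrixP => i j; rewrite [j]ord1.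
by have := eqvw (enum_val i); rewrite /amp !enum_valK.
Qed.

Lemma reindex_bits n (f : 'I_#|{: bits n}| -> C) :
  \sum_i f i = \sum_(x : bits n) f (enum_rank x).
Proof. by apply: reindex; exists enum_val => i _; rewrite (enum_rankK, enum_valK). Qed.

Lemma entryM n (A B : qop C n) x z :
  entry (A *m B) x z = \sum_y entry A x y * entry B y z.
Proof. by rewrite /entry mxE reindex_bits. Qed.

Lemma ampM n (A : qop C n) v x : amp (A *m v) x = \sum_y entry A x y * amp v y.
Proof. by rewrite /amp mxE reindex_bits. Qed.

Lemma entry1 n (x y : bits n) : entry (1%:M : qop C n) x y = (x == y)%:R.
Proof. by rewrite /entry mxE (inj_eq enum_rank_inj). Qed.

Lemma entryC n (A : qop C n) x y : entry (A ^t*) x y = (entry A y x)^*.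
Proof. by rewrite /entry !mxE. Qed.

Lemma ampC n (v : qstate C n) x : (v ^t*) 0 (enum_rank x) = (amp v x)^*.
Proof. by rewrite /amp !mxE. Qed.

Lemma entry_ketbra n (z x y : bits n) :
  entry (ketbra C z) x y = (x == z)%:R * (y == z)%:R.
Proof.
rewrite /entry /ketbra mxE big_ord1 ampC -/(amp _ _) !amp_mkstate.
by case: (y == z); rewrite (conjC0, conjC1).
Qed.

Lemma sum_bool (f : bool -> C) : \sum_b f b = f false + f true.
Proof. by rewrite big_bool addrC. Qed.

Lemma bit2ord_inj : injective bit2ord.
Proof. by do 2 case. Qed.

Lemma mulmx_bit (A B : 'M[C]_2) i j :
  (A *m B) i j = \sum_b A i (bit2ord b) * B (bit2ord b) j.
Proof.
rewrite mxE sum_bool !big_ord_recl big_ord0 addr0.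
by congr (_ * _ + _ * _); congr (_ _ _); apply/val_inj.
Qed.

Lemma one_bit b b' : (1%:M : 'M[C]_2) (bit2ord b) (bit2ord b') = (b == b')%:R.
Proof. by rewrite mxE (inj_eq bit2ord_inj). Qed.

Lemma prodb (I : finType) (P Q : pred I) :
  \prod_(i | P i) (Q i)%:R = [forall i, P i ==> Q i]%:R :> C.
Proof.
case: forallP => [allQ|nQ].
  by rewrite big1 // => i Pi; have := allQ i; rewrite Pi => /= ->.
have : ~~ [forall i, P i ==> Q i] by apply/forallP.
case/forallPn => i.
rewrite negb_imply => /andP[Pi nQi].
by rewrite (bigD1 i) //= (negPf nQi) mul0r.
Qed.

(** Row [x] is taken from the tensor product of the matrices [F x k]. Letting the factors depend on
    the row covers tensor powers, controlled gates and label-selected operators in one form. *)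
Definition local_op n (F : bits n -> 'I_n -> 'M[C]_2) : qop C n :=
  mkop (fun x y => \prod_k F x k (bit2ord (x k)) (bit2ord (y k))).

Lemma eq_local_op n (F F' : bits n -> 'I_n -> 'M[C]_2) :
  (forall x k, F x k = F' x k) -> local_op F = local_op F'.
Proof. by move=> e; apply: opP => x y; rewrite !entry_mkop; apply: eq_bigr => k _; rewrite e. Qed.

Lemma local_op1 n : local_op (fun (_ : bits n) _ => 1%:M) = 1%:M.
Proof.
apply: opP => x y; rewrite entry_mkop entry1.
under eq_bigr do rewrite one_bit.
rewrite prodb; congr (_%:R); congr nat_of_bool.
by apply/forallP/eqP => [e|-> k]; [apply/ffunP => k; exact/eqP/e|rewrite eqxx].
Qed.

(** An entry of the left factor vanishes unless [x] and [y] agree wherever [F x k] is the identity.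
    For the surviving [y], [F' y] may be replaced by [F' x], and the sum over [y] of a product over
    qubits becomes a product of single-qubit sums. *)
Lemma local_opM n (F F' : bits n -> 'I_n -> 'M[C]_2) :
    (forall x y : bits n, (forall k, F x k = 1%:M -> x k = y k) -> forall k, F' y k = F' x k) ->
  local_op F *m local_op F' = local_op (fun x k => F x k *m F' x k).
Proof.
move=> compat; apply: opP => x z; rewrite entryM !entry_mkop.
transitivity (\sum_(y : bits n) \prod_k
    (F x k (bit2ord (x k)) (bit2ord (y k)) * F' x k (bit2ord (y k)) (bit2ord (z k)))).
  apply: eq_bigr => y _; rewrite !entry_mkop.
  case: (boolP [forall k, (F x k == 1%:M) ==> (x k == y k)]) => [/forallP e|].
    rewrite -big_split; apply: eq_bigr => k _ /=; rewrite (@compat x y) // => j Fj.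
    by have := e j; rewrite Fj eqxx => /eqP.
  case/forallPn => k; rewrite negb_imply => /andP[/eqP Fk ne].
  rewrite (bigD1 k) //= [RHS](bigD1 k) //= Fk one_bit (negPf ne).
  by rewrite !mul0r.
under [RHS]eq_bigr do rewrite mulmx_bit.
by rewrite bigA_distr_bigA.
Qed.

(** If [x] and [y] agree wherever [F x] is the identity, then [F y] and [F x] coincide and the
    entries match factor by factor; otherwise an identity factor kills both sides. *)
Lemma local_opC n (F : bits n -> 'I_n -> 'M[C]_2) :
    (forall x y : bits n, (forall k, F x k = 1%:M -> x k = y k) -> forall k, F y k = F x k) ->
  (local_op F) ^t* = local_op (fun x k => (F x k) ^t*).
Proof.
move=> compat; apply: opP => x y; rewrite entryC !entry_mkop rmorph_prod.
case: (boolP [forall k, (F x k == 1%:M) ==> (x k == y k)]) => [/forallP e|].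
  apply: eq_bigr => k _; rewrite !mxE (@compat x y) // => j Fj.
  by have := e j; rewrite Fj eqxx => /eqP.
case/forallPn => k0; rewrite negb_imply => /andP[/eqP Fk ne].
rewrite [RHS](bigD1 k0) //= !mxE Fk one_bit eq_sym (negPf ne) conjC0 mul0r.
case: (boolP [forall k, (F y k == 1%:M) ==> (y k == x k)]) => [/forallP e|].
  rewrite (bigD1 k0) //= -(@compat y x) ?Fk ?one_bit 1?eq_sym ?(negPf ne) ?conjC0 ?mul0r//.
  by move=> j Fj; have := e j; rewrite Fj eqxx => /eqP.
case/forallPn => k; rewrite negb_imply => /andP[/eqP Fk' ne'].
by rewrite (bigD1 k) //= Fk' one_bit (negPf ne') conjC0 mul0r.
Qed.

(* The operator applying the single-qubit operator [A x] to every qubit of [S],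
   where [A] is meant to depend only on the qubits outside [S]. *)
Definition loc n (S : {set 'I_n}) (A : bits n -> 'M[C]_2) : qop C n :=
  local_op (fun x k => if k \in S then A x else 1%:M).

Definition agree_off n (S : {set 'I_n}) (x y : bits n) := forall k, k \notin S -> x k = y k.

Definition indep n (S : {set 'I_n}) T (A : bits n -> T) :=
  forall x y, agree_off S x y -> A x = A y.

Lemma eq_loc n (S : {set 'I_n}) A B : (forall x, A x = B x) -> loc S A = loc S B.
Proof. by move=> e; apply: eq_local_op => x k; rewrite e. Qed.

Lemma loc1 n (S : {set 'I_n}) : loc S (fun=> 1%:M) = 1%:M.
Proof. by rewrite -[RHS]local_op1; apply: eq_local_op => x k; rewrite if_same. Qed.

Lemma locM n (S : {set 'I_n}) A B : indep S B ->
  loc S A *m loc S B = loc S (fun x => A x *m B x).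
Proof.
move=> iB; rewrite /loc local_opM => [|x y e k].
  by apply: eq_local_op => x k; case: ifP => // _; rewrite mul1mx.
case: ifP => // _; apply: iB => j jS; symmetry; apply: e.
by rewrite (negPf jS).
Qed.

Lemma locU n (S1 S2 : {set 'I_n}) A : [disjoint S1 & S2] -> indep (S1 :|: S2) A ->
  loc S1 A *m loc S2 A = loc (S1 :|: S2) A.
Proof.
move=> dis iA; rewrite /loc local_opM => [|x y e k].
  apply: eq_local_op => x k; rewrite inE.
  case: ifP => k1; rewrite ?mul1mx //.
  by rewrite (disjointFr dis k1) mulmx1.
case: ifP => // _; apply: iA => j; rewrite inE negb_or => /andP[j1 j2]; symmetry; apply: e.
by rewrite (negPf j1).
Qed.

Lemma locC n (S : {set 'I_n}) A : indep S A -> (loc S A) ^t* = loc S (fun x => (A x) ^t*).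
Proof.
move=> iA; rewrite /loc local_opC => [|x y e k].
  apply: eq_local_op => x k; case: ifP => // _.
  by rewrite tr_scalar_mx map_scalar_mx rmorph1.
case: ifP => // _; apply: iA => j jS; symmetry; apply: e.
by rewrite (negPf jS).
Qed.

Lemma loc_unitary n (S : {set 'I_n}) A : indep S A ->
  (forall x, A x \is unitarymx) -> loc S A \is unitarymx.
Proof.
move=> iA uA; apply/unitarymxP; rewrite locC // locM; last first.
  by move=> x y e; rewrite (iA _ _ e).
by rewrite -[RHS](loc1 S); apply: eq_loc => x; apply/unitarymxP.
Qed.

Lemma entry_loc n (S : {set 'I_n}) A x y :
  entry (loc S A) x y = (\prod_(k in S) A x (bit2ord (x k)) (bit2ord (y k)))
    * [forall k, (k \notin S) ==> (x k == y k)]%:R.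
Proof.
rewrite entry_mkop (bigID (mem S)) /=; congr (_ * _).
  by apply: eq_bigr => k ->.
rewrite -prodb; apply: eq_bigr => k /negPf ->; exact: one_bit.
Qed.

(** The amplitude at [x] after applying this operator is the old amplitude at [s x]. Composition is
    therefore contravariant. *)
Definition pull n (s : bits n -> bits n) : qop C n := mkop (fun x y => (y == s x)%:R).

Lemma entry_pullM n s (A : qop C n) x y : entry (pull s *m A) x y = entry A (s x) y.
Proof.
rewrite entryM (bigD1 (s x)) //= entry_mkop eqxx mul1r big1 ?addr0 // => z /negPf ne.
by rewrite entry_mkop ne mul0r.
Qed.

Lemma entry_Mpull n s (A : qop C n) x y : involutive s ->
  entry (A *m pull s) x y = entry A x (s y).
Proof.
move=> sK; rewrite entryM (bigD1 (s y)) //= entry_mkop sK eqxx mulr1 big1 ?addr0 // => z ne.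
by rewrite entry_mkop eq_sym (inv_eq sK) (negPf ne) mulr0.
Qed.

Lemma pullM n (s1 s2 : bits n -> bits n) : pull s2 *m pull s1 = pull (s1 \o s2).
Proof. by apply: opP => x y; rewrite entry_pullM !entry_mkop. Qed.

Lemma pull_id n (s : bits n -> bits n) : s =1 id -> pull s = 1%:M.
Proof. by move=> e; apply: opP => x y; rewrite entry_mkop entry1 e eq_sym. Qed.

Lemma eq_pull n (s s' : bits n -> bits n) : s =1 s' -> pull s = pull s'.
Proof. by move=> e; apply: opP => x y; rewrite !entry_mkop e. Qed.

(** Conjugation relabels rows and columns by [s]. The bits in [S] are untouched, and agreement off
    [S] is preserved both ways because [s] is its own inverse, so only the argument of [A]
    changes. *)
Lemma loc_conj n (S : {set 'I_n}) A (s : bits n -> bits n) : involutive s ->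
    (forall (x : bits n) k, k \in S -> s x k = x k) ->
    (forall x y, agree_off S x y -> agree_off S (s x) (s y)) ->
  pull s *m loc S A *m pull s = loc S (A \o s).
Proof.
move=> sK sS sN; apply: opP => x y.
rewrite entry_Mpull // entry_pullM !entry_loc; congr (_ * _).
  by apply: eq_bigr => k kS; rewrite !sS.
congr (nat_of_bool _)%:R.
apply/forallP/forallP => e k; apply/implyP => kS; apply/eqP.
  rewrite -[x]sK -[y]sK; apply: sN => // j jS.
  by have := e j; rewrite jS => /eqP.
apply: sN => // j jS.
by have := e j; rewrite jS => /eqP.
Qed.

End Operators.

(** * Elementary gates as local operators, and the square root of the NOT gate *)

Section Gates.
Variable C : numClosedFieldType.
Implicit Types n : nat.

Lemma entry_loc1 n (t : 'I_n) (A : bits n -> 'M[C]_2) x y :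
  entry (loc [set t] A) x y = A x (bit2ord (x t)) (bit2ord (y t))
    * [forall k, (k != t) ==> (x k == y k)]%:R.
Proof.
rewrite entry_loc big_set1; congr (_ * (nat_of_bool _)%:R).
by apply: eq_forallb => k; rewrite inE.
Qed.

Lemma bits1E (u v : bits 1) : (u == v) = (u 0 == v 0).
Proof.
by apply/eqP/eqP => [->|e] //; apply/ffunP => i; rewrite (ord1 i).
Qed.

Lemma entry_ctrl_op (A : 'M[C]_2) (u v : bits (1 + 1)) :
  entry (ctrl_op A) u v
  = (u 0 == v 0)%:R * (if u 0 then A else 1%:M) (bit2ord (u 1)) (bit2ord (v 1)).
Proof.
have entryD (P Q : qop C (1 + 1)) : entry (P + Q) u v = entry P u v + entry Q u v by rewrite /entry mxE.
rewrite /ctrl_op /tens_op entryD !entry_mkop !entry_ketbra entry1 big_ord1.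
have e0 : lshift 1 (0 : 'I_1) = 0 by apply/val_inj.
have e1 : rshift 1 (0 : 'I_1) = 1 by apply/val_inj.
rewrite !bits1E !ffunE e0 e1.
case: (u 0); case: (v 0); rewrite /= ?(mul0r, mul1r, mulr0, add0r, addr0) //.
by rewrite one_bit.
Qed.

Lemma ctrl_opE (A : 'M[C]_2) :
  ctrl_op A = loc [set (1 : 'I_(1 + 1))] (fun x : bits (1 + 1) => if x 0 then A else 1%:M).
Proof.
apply: opP => x y; rewrite entry_ctrl_op entry_loc1 mulrC; congr (_ * (nat_of_bool _)%:R).
apply/idP/forallP => [/eqP e k|/(_ 0)] //.
by case: k => -[|[|]] // lt; rewrite /= [Ordinal lt](_ : _ = 0) ?e ?eqxx //; apply/val_inj.
Qed.

Lemma ctrl_op_unitary (A : 'M[C]_2) : A \is unitarymx -> ctrl_op A \is unitarymx.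
Proof.
move=> uA; rewrite ctrl_opE; apply: loc_unitary => [x y e|x].
  by rewrite e // inE.
by case: (x 0) => //; apply/unitarymxP; rewrite tr_scalar_mx map_scalar_mx rmorph1 mulmx1.
Qed.

Lemma tpow_opE n (A : 'M[C]_2) : tpow_op n A = loc [set: 'I_n] (fun=> A).
Proof.
apply: opP => x y; rewrite !entry_mkop.
by apply: eq_bigr => k _; rewrite inE.
Qed.

Lemma tpow_op_unitary n (A : 'M[C]_2) : A \is unitarymx -> tpow_op n A \is unitarymx.
Proof. by move=> uA; rewrite tpow_opE; apply: loc_unitary. Qed.

Lemma codom_ctrl n (A : 'M[C]_2) (c t k : 'I_n) :
  (k \in codom (gate_pos (ctrl_gate A c t))) = (k == c) || (k == t).
Proof.
apply/codomP/orP => [[i ->]|]; first by rewrite ffunE; case: (i == 0); rewrite eqxx; [left|right].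
by case=> /eqP ->; [exists 0|exists 1]; rewrite ffunE.
Qed.

Lemma elementary_ctrl n (A : 'M[C]_2) (c t : 'I_n) :
  A \is unitarymx -> c != t -> elementary (ctrl_gate A c t).
Proof.
move=> uA ct; apply/and3P; split=> //; last exact: ctrl_op_unitary.
apply/injectiveP => i j; rewrite !ffunE => e; apply/val_inj.
case: i j e => -[|[|]] //= i [[|[|]]] //= j e.
  by rewrite e eqxx in ct.
by rewrite -e eqxx in ct.
Qed.

Lemma gate_op_ctrl n (A : 'M[C]_2) (c t : 'I_n) : c != t ->
  gate_op (ctrl_gate A c t) = loc [set t] (fun x => if x c then A else 1%:M).
Proof.
move=> ct; apply: opP => x y; rewrite entry_mkop entry_loc1 entry_ctrl_op !ffunE /=.
rewrite -mulrA mulrCA; congr (_ * _); rewrite -natrM mulnb; congr (nat_of_bool _)%:R.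
apply/andP/forallP => [[e2 /forallP e1] k|e].
  have := e1 k; rewrite (codom_ctrl A) negb_or; case: (eqVneq k c) => [->|] //=.
  by rewrite e2 implybT.
split; first by have := e c; rewrite ct.
apply/forallP => k; rewrite (codom_ctrl A) negb_or; apply/implyP => /andP[_ kt].
by have := e k; rewrite kt.
Qed.

Definition single_gate n (A : 'M[C]_2) (t : 'I_n) : gate C n :=
  @Gate C n 1 (tpow_op 1 A) [ffun=> t].

Lemma codom_single n (A : 'M[C]_2) (t k : 'I_n) :
  (k \in codom (gate_pos (single_gate A t))) = (k == t).
Proof.
apply/codomP/eqP => [[i ->]|->]; first by rewrite ffunE.
by exists 0; rewrite ffunE.
Qed.

Lemma elementary_single n (A : 'M[C]_2) (t : 'I_n) :
  A \is unitarymx -> elementary (single_gate A t).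
Proof.
move=> uA; apply/and3P; split=> //; last exact: tpow_op_unitary.
by apply/injectiveP => i j _; rewrite (ord1 i) (ord1 j).
Qed.

Lemma gate_op_single n (A : 'M[C]_2) (t : 'I_n) :
  gate_op (single_gate A t) = loc [set t] (fun=> A).
Proof.
apply: opP => x y; rewrite entry_mkop entry_loc1 entry_mkop big_ord1 !ffunE.
congr (_ * (nat_of_bool _)%:R).
by apply: eq_forallb => k; rewrite (codom_single A).
Qed.

Definition gates_op n (l : seq (gate C n)) : qop C n :=
  foldl (fun M g => gate_op g *m M) 1%:M l.

Lemma gates_op_cat n (l1 l2 : seq (gate C n)) :
  gates_op (l1 ++ l2) = gates_op l2 *m gates_op l1.
Proof.
rewrite /gates_op foldl_cat; elim/last_ind: l2 => [|l g IH]; first by rewrite /= mul1mx.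
by rewrite !foldl_rcons IH mulmxA.
Qed.

Lemma gates_op1 n (g : gate C n) : gates_op [:: g] = gate_op g.
Proof. exact: mulmx1. Qed.

Lemma gates_op_cons n (g : gate C n) l : gates_op (g :: l) = gates_op l *m gate_op g.
Proof. by rewrite -cat1s gates_op_cat gates_op1. Qed.

Lemma gates_op_nil n : gates_op [::] = 1%:M :> qop C n.
Proof. by []. Qed.

Definition pauliX : 'M[C]_2 := \matrix_(i, j) (i != j)%:R.

(** The square root of X with eigenvalue 1 on |+> and ['i] on |->. *)
Definition sqrtX : 'M[C]_2 := ((1 + 'i) / 2)%:M + ((1 - 'i) / 2) *: pauliX.

Lemma pauliX2 : pauliX *m pauliX = 1%:M.
Proof.
by apply/matrixP => i j; rewrite !mxE !big_ord_recl big_ord0 !mxE;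
  case: i => -[|[|]] // ?; case: j => -[|[|]] // ? /=; rewrite ?(mulr0, mulr1, addr0, add0r).
Qed.

Lemma pauliXC : pauliX ^t* = pauliX.
Proof. by apply/matrixP => i j; rewrite !mxE eq_sym conjC_nat. Qed.

Lemma sqrtXC : sqrtX ^t* = ((1 - 'i) / 2)%:M + ((1 + 'i) / 2) *: pauliX.
Proof.
have e1 : ((1 + 'i) / 2)^* = (1 - 'i) / 2 :> C.
  by rewrite rmorphM rmorphD rmorph1 /= conjCi fmorphV rmorph_nat.
have e2 : ((1 - 'i) / 2)^* = (1 + 'i) / 2 :> C by rewrite -e1 conjCK.
by rewrite /sqrtX linearD /= map_mxD /= tr_scalar_mx map_scalar_mx /= linearZ /= map_mxZ /= pauliXC e1 e2.
Qed.

Lemma mulmx_lincomb (a b c d : C) :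
  (a%:M + b *: pauliX) *m (c%:M + d *: pauliX)
  = (a * c + b * d)%:M + (a * d + b * c) *: pauliX.
Proof.
move: pauliX pauliX2 => X X2; rewrite -(scalemx1 _ a) -(scalemx1 _ c) -(scalemx1 _ (_ + _)).
rewrite mulmxDl !mulmxDr -!scalemxAl -!scalemxAr !mul1mx !mulmx1 X2.
rewrite !scalerA !scalerDl.
by rewrite [X in _ + X]addrC addrACA.
Qed.

Lemma sqrtX2 : sqrtX *m sqrtX = pauliX.
Proof.
have i2 : 'i * 'i = -1 :> C by rewrite -expr2 sqrCi.
rewrite mulmx_lincomb.
have -> : (1 + 'i) / 2 * ((1 + 'i) / 2) + (1 - 'i) / 2 * ((1 - 'i) / 2) = 0 :> C by field: i2.
have -> : (1 + 'i) / 2 * ((1 - 'i) / 2) + (1 - 'i) / 2 * ((1 + 'i) / 2) = 1 :> C by field: i2.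
by rewrite scale1r raddf0 add0r.
Qed.

Lemma sqrtXK : sqrtX *m sqrtX ^t* = 1%:M.
Proof.
have i2 : 'i * 'i = -1 :> C by rewrite -expr2 sqrCi.
rewrite sqrtXC mulmx_lincomb.
have -> : (1 + 'i) / 2 * ((1 - 'i) / 2) + (1 - 'i) / 2 * ((1 + 'i) / 2) = 1 :> C by field: i2.
have -> : (1 + 'i) / 2 * ((1 + 'i) / 2) + (1 - 'i) / 2 * ((1 - 'i) / 2) = 0 :> C by field: i2.
by rewrite scale0r addr0.
Qed.

Lemma sqrtX_unitary : sqrtX \is unitarymx.
Proof. by apply/unitarymxP; exact: sqrtXK. Qed.

Lemma pauliX_unitary : pauliX \is unitarymx.
Proof. by apply/unitarymxP; rewrite pauliXC pauliX2. Qed.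

Lemma sqrtXC_unitary : sqrtX ^t* \is unitarymx.
Proof. by rewrite trmxC_unitary sqrtX_unitary. Qed.

Definition flip n (p : bits n -> bool) (t : 'I_n) (x : bits n) : bits n :=
  [ffun k => x k (+) ((k == t) && p x)].

Lemma flip_id n (p : bits n -> bool) t x k : k != t -> flip p t x k = x k.
Proof. by move=> /negPf kt; rewrite ffunE kt addbF. Qed.

Lemma flip_agree n (p : bits n -> bool) t x : agree_off [set t] (flip p t x) x.
Proof. by move=> k; rewrite inE => /flip_id ->. Qed.

Lemma flipK n (p : bits n -> bool) t : indep [set t] p -> involutive (flip p t).
Proof.
move=> ip x; apply/ffunP => k; rewrite !ffunE (ip _ _ (@flip_agree _ p t x)).
by rewrite -addbA addbb addbF.
Qed.

(** Passes from the matrix description of a controlled NOT to a permutation of labels, where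
    multi-controlled gates can be computed on Boolean functions. *)
Lemma loc_pauliX n (p : bits n -> bool) t :
  loc [set t] (fun x => if p x then pauliX else 1%:M) = pull C (flip p t).
Proof.
apply: opP => x y; rewrite entry_loc1 entry_mkop.
have -> : (if p x then pauliX else 1%:M) (bit2ord (x t)) (bit2ord (y t))
   = (y t == x t (+) p x)%:R.
  case: (p x); rewrite ?one_bit 1?eq_sym ?addbF // mxE (inj_eq bit2ord_inj) addbT.
  by case: (x t); case: (y t).
rewrite -natrM mulnb; congr (nat_of_bool _)%:R.
apply/andP/eqP => [[/eqP et /forallP e]|->].
  apply/ffunP => k; rewrite ffunE; case: (eqVneq k t) => [->|kt] //=.
  by have := e k; rewrite kt addbF => /eqP.
rewrite ffunE eqxx /=; split=> //; apply/forallP => k.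
by apply/implyP => kt; rewrite flip_id.
Qed.

End Gates.

(** * Toffoli gates and multi-controlled NOT gates with borrowed qubits *)

Section Toffoli.
Variable C : numClosedFieldType.
Variable n : nat.
Implicit Types (a b c d t : 'I_n) (x : bits n).

Definition cnot a b : gate C n := ctrl_gate (pauliX C) a b.

(* Barenco et al.: with V^2 = X, the product V^a V^b V^-(a+b mod 2) is X^(a b).
   The controlled V's commute, so the last CNOT may be split off. *)
Definition toffoli_head a b t : seq (gate C n) :=
  [:: ctrl_gate (sqrtX C) a t; ctrl_gate (sqrtX C) b t; cnot a b;
      ctrl_gate ((sqrtX C) ^t*) b t].

(** The mirror image of the head: its missing [cnot a b] comes first instead of last, so that it can
    cancel the one missing from the head across a middle operator commuting with it. *)
Definition toffoli_tail a b t : seq (gate C n) :=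
  [:: ctrl_gate ((sqrtX C) ^t*) b t; cnot a b;
      ctrl_gate (sqrtX C) a t; ctrl_gate (sqrtX C) b t].

Definition toffoli a b t := toffoli_head a b t ++ [:: cnot a b].

Definition triple_ok (g : 'I_n * 'I_n * 'I_n) :=
  let: (a, b, t) := g in [&& a != b, a != t & b != t].

Lemma elementary_toffoli_head a b t : triple_ok (a, b, t) -> all (@elementary C n) (toffoli_head a b t).
Proof.
by case/and3P => ab at_ bt; rewrite /= !elementary_ctrl ?sqrtX_unitary ?pauliX_unitary ?sqrtXC_unitary.
Qed.

Lemma elementary_toffoli_tail a b t : triple_ok (a, b, t) -> all (@elementary C n) (toffoli_tail a b t).
Proof.
by case/and3P => ab at_ bt; rewrite /= !elementary_ctrl ?sqrtX_unitary ?pauliX_unitary ?sqrtXC_unitary.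
Qed.

Lemma elementary_toffoli a b t : triple_ok (a, b, t) -> all (@elementary C n) (toffoli a b t).
Proof.
move=> ok; rewrite all_cat elementary_toffoli_head //= elementary_ctrl ?pauliX_unitary //.
by case/and3P: ok.
Qed.

Lemma indep_bit (S : {set 'I_n}) c T (f : bool -> T) : c \notin S -> indep S (fun x => f (x c)).
Proof. by move=> cS x y e; rewrite e. Qed.

Lemma gate_op_cnot a b : a != b -> gate_op (cnot a b) = pull C (flip (fun x => x a) b).
Proof. by move=> ab; rewrite gate_op_ctrl // loc_pauliX. Qed.

Lemma cnot_conj a b t A : a != b -> a != t -> b != t ->
  gate_op (cnot a b) *m loc [set t] A *m gate_op (cnot a b)
  = loc [set t] (fun x => A (flip (fun x => x a) b x)) :> qop C n.
Proof.
move=> ab at_ bt; rewrite gate_op_cnot // loc_conj //.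
- by apply: flipK; apply: (@indep_bit _ a _ id); rewrite inE.
- by move=> x k; rewrite inE => /eqP ->; rewrite flip_id // eq_sym.
move=> x y e k kt; rewrite !ffunE e //; case: (k == b) => //=.
by rewrite e // inE.
Qed.

Lemma gates_op_toffoli a b t : triple_ok (a, b, t) ->
  gates_op (toffoli a b t) = pull C (flip (fun x => x a && x b) t).
Proof.
case/and3P => ab at_ bt; rewrite !gates_op_cons gates_op_nil mul1mx.
(* The two CNOTs around the inverse root turn its control [b] into the parity of [a] and [b]. *)
rewrite [gate_op (ctrl_gate _ b t)]gate_op_ctrl // cnot_conj //.
rewrite !gate_op_ctrl // !locM; try by move=> x y e; rewrite !e ?inE.
rewrite -loc_pauliX; apply: eq_loc => x; rewrite !ffunE eqxx /=.
have VK : (sqrtX C) ^t* *m sqrtX C = 1%:M by apply: mulmx1C; exact: sqrtXK.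
by case: (x a); case: (x b); rewrite /= ?mul1mx ?mulmx1 ?sqrtX2 ?VK.
Qed.

Lemma gates_op_toffoli_rev a b t : triple_ok (a, b, t) ->
  gates_op (cnot a b :: toffoli_tail a b t) = pull C (flip (fun x => x a && x b) t).
Proof.
case/and3P => ab at_ bt; rewrite !gates_op_cons gates_op_nil mul1mx -!mulmxA.
rewrite [gate_op (ctrl_gate _ b t) in X in _ *m X]gate_op_ctrl //.
rewrite [gate_op (cnot a b) *m _]mulmxA cnot_conj //.
rewrite !gate_op_ctrl // !locM; try by move=> x y e; rewrite ?ffunE !e ?inE.
rewrite -loc_pauliX; apply: eq_loc => x; rewrite !ffunE eqxx /=.
by case: (x a); case: (x b); rewrite /= ?mul1mx ?mulmx1 ?sqrtX2 ?sqrtXK.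
Qed.

Definition run_triple (g : 'I_n * 'I_n * 'I_n) : bits n -> bits n :=
  let: (a, b, t) := g in flip (fun x => x a && x b) t.

(* The operators act by pull-back, so the last Toffoli acts first on labels. *)
Definition run (s : seq ('I_n * 'I_n * 'I_n)) (x : bits n) : bits n := foldr run_triple x s.

Definition net (s : seq ('I_n * 'I_n * 'I_n)) : seq (gate C n) :=
  flatten [seq (let: (a, b, t) := g in toffoli a b t) | g <- s].

Lemma run_cat s1 s2 x : run (s1 ++ s2) x = run s1 (run s2 x).
Proof. exact: foldr_cat. Qed.

Lemma size_net s : size (net s) = (5 * size s)%N.
Proof. by elim: s => //= -[[a b] t] s IH; rewrite size_cat IH mulnS. Qed.

Lemma elementary_net s : all triple_ok s -> all (@elementary C n) (net s).
Proof.
elim: s => //= -[[a b] t] s IH /andP[ok oks].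
by rewrite all_cat IH // andbT; apply: elementary_toffoli.
Qed.

Lemma gates_op_net s : all triple_ok s -> gates_op (net s) = pull C (run s).
Proof.
elim: s => [_|[[a b] t] s IH /andP[ok oks]]; first by rewrite pull_id.
by rewrite (_ : net _ = toffoli a b t ++ net s) // gates_op_cat IH // gates_op_toffoli // pullM.
Qed.

(* [ladder ds cs t] adds the conjunction of [cs] to [t], but also adds conjunctions of
   controls to the borrowed qubits [ds]; [mcx] undoes the latter by a shorter ladder. *)
Fixpoint ladder (ds cs : seq 'I_n) t : seq ('I_n * 'I_n * 'I_n) :=
  match ds, cs with
  | [::], [:: c; c'] => [:: (c, c', t)]
  | d :: ds', c :: cs' => (c, d, t) :: rcons (ladder ds' cs' d) (c, d, t)
  | _, _ => [::]
  end.

(** The toggling pattern of a ladder: [t] by the conjunction of [cs], and each successive borrowed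
    qubit by the conjunction of the corresponding tail of [cs]. *)
Fixpoint ladder_mask (ds cs : seq 'I_n) t x k : bool :=
  ((k == t) && all x cs)
  || (if (ds, cs) is (d :: ds', _ :: cs') then ladder_mask ds' cs' d x k else false).

Definition mcx (ds cs : seq 'I_n) t :=
  ladder ds cs t ++ (if (ds, cs) is (d :: ds', _ :: cs') then ladder ds' cs' d else [::]).

Lemma ladder_mask_eq ds (cs : seq 'I_n) t (x y : bits n) : {in cs, x =1 y} ->
  ladder_mask ds cs t x =1 ladder_mask ds cs t y.
Proof.
elim: ds cs t => [|d ds IH] [|c cs] t e k //=; rewrite (e c) ?mem_head //;
  have e' : {in cs, x =1 y} by move=> j jcs; apply: e; rewrite inE jcs orbT.
  by rewrite (eq_in_all e').
by rewrite (eq_in_all e') (IH cs d e').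
Qed.

Lemma ladder_mask_out ds cs t x k : k \notin t :: ds -> ladder_mask ds cs t x k = false.
Proof.
elim: ds cs t => [|d ds IH] cs t; first by rewrite inE => /negPf /= ->; case: cs.
rewrite inE negb_or => /andP[/negPf /= -> kds] /=.
by case: cs => //= c cs; rewrite IH.
Qed.

(** By induction the inner ladder toggles [d] by the conjunction of the remaining controls. The two
    outer Toffolis see [d] before and after, so their effects on [t] add up to [c] times that
    conjunction. *)
Lemma run_ladder ds cs t x : size cs = (size ds).+2 -> uniq (t :: ds ++ cs) ->
  run (ladder ds cs t) x = [ffun k => x k (+) ladder_mask ds cs t x k].
Proof.
elim: ds cs t x => [|d ds IH] cs t x.
  case: cs => [|c [|c' []]] //= _ _.
  by apply/ffunP => k; rewrite !ffunE andbT orbF.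
case: cs => [|c cs] //= [sz] /and3P[].
rewrite !inE !mem_cat !inE !negb_or => /and4P[td tds tc tcs] /and3P[dds dc dcs].
rewrite cat_uniq /= negb_or => /and3P[uds /andP[cds hds] /andP[ccs ucs]].
rewrite -cats1 run_cat /= IH //; last by rewrite /= mem_cat negb_or dds dcs cat_uniq uds hds.
have me : ladder_mask ds cs d (flip (fun x => x c && x d) t x) =1 ladder_mask ds cs d x.
  apply: ladder_mask_eq => j jcs; rewrite flip_id //; apply: contraNneq tcs => <- //.
have mc : ladder_mask ds cs d x c = false.
  by apply: ladder_mask_out; rewrite inE negb_or eq_sym dc.
have mt : ladder_mask ds cs d x t = false.
  by apply: ladder_mask_out; rewrite inE negb_or td.
have md : ladder_mask ds cs d x d = all x cs.
  case: (ds) dds => [|d' ds'] dds; case: (cs) => [|c' cs']; rewrite /= eqxx /= ?orbF //.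
  by rewrite ladder_mask_out // orbF.
apply/ffunP => k; rewrite !ffunE !me mc md.
rewrite (eq_sym c) (negPf tc) (eq_sym d) (negPf td) /= ?addbF.
case: (eqVneq k t) => [->|kt] /=; rewrite ?mt ?addbF ?orbF //.
by case: (x t); case: (x c); case: (x d); case: (all x cs).
Qed.

(** Both ladders toggle the borrowed qubits by the same masks, since the controls never change; the
    masks cancel everywhere except at [t], which only the longer ladder toggles. *)
Lemma run_mcx ds cs t x : size cs = (size ds).+2 -> uniq (t :: ds ++ cs) ->
  run (mcx ds cs t) x = flip (fun x => all x cs) t x.
Proof.
move=> sz u; rewrite /mcx run_cat.
case: ds cs sz u => [|d ds] [|c cs] // sz u.
  rewrite run_ladder //; apply/ffunP => k; rewrite !ffunE /=.
  by rewrite orbF.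
rewrite [run (ladder ds cs d) x]run_ladder; last 2 first.
- by case: sz.
- move: u => /= /andP[_]; rewrite !mem_cat inE !negb_or => /andP[/and3P[-> _ ->]].
  by rewrite !cat_uniq /= negb_or => /and3P[-> /andP[_ ->] /andP[_ ->]].
set y := [ffun k => _].
have yc : {in c :: cs, y =1 x}.
  move=> j jcs; rewrite ffunE ladder_mask_out ?addbF //.
  move: u; rewrite -cat_cons cat_uniq => /and3P[_ /hasPn h _].
  by have := h _ jcs; rewrite !inE !negb_or => /and3P[_ -> ->].
rewrite run_ladder //; apply/ffunP => k; rewrite ffunE (ladder_mask_eq _ _ yc) /y !ffunE /=.
case: (eqVneq k t) => [->|kt] /=; last by rewrite -addbA addbb.
rewrite ladder_mask_out ?addbF ?orbF //.
by move: u => /= /andP[]; rewrite !inE !mem_cat !negb_or => /and3P[-> -> _].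
Qed.

Lemma size_ladder ds cs t : (size (ladder ds cs t) <= (2 * size ds).+1)%N.
Proof.
elim: ds cs t => [|d ds IH] cs t; first by case: cs => [|? [|? []]].
case: cs => //= c cs; rewrite size_rcons.
by have := IH cs d; lia.
Qed.

(** For nonempty [ds] the two ladders have at most 2d + 1 and 2d - 1 gates, d being the size of
    [ds], which makes 4d; the extra 1 is the single Toffoli of the case d = 0. *)
Lemma size_mcx ds cs t : (size (mcx ds cs t) <= (4 * size ds).+1)%N.
Proof.
rewrite size_cat; have := size_ladder ds cs t.
case: ds cs => [|d ds] [|c cs] /=; try lia.
by have := size_ladder ds cs d; lia.
Qed.

Lemma ladder_ok ds cs t : uniq (t :: ds ++ cs) -> all triple_ok (ladder ds cs t).
Proof.
elim: ds cs t => [|d ds IH] cs t.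
  case: cs => [|c [|c' []]] //=; rewrite !inE !negb_or !andbT.
  by move=> /andP[/andP[tc tc'] ->]; rewrite (eq_sym c) (eq_sym c') tc tc'.
case: cs => [|c cs] // u; rewrite /= all_rcons IH; last first.
  move: u => /= /andP[_]; rewrite !mem_cat inE !negb_or => /andP[/and3P[-> _ ->]].
  by rewrite !cat_uniq /= negb_or => /and3P[-> /andP[_ ->] /andP[_ ->]].
move: u; rewrite /= inE !mem_cat !inE !negb_or => /and3P[/and4P[td _ tc _] /and3P[_ dc _] _].
by rewrite ![c == _]eq_sym dc tc (eq_sym d) td.
Qed.

Lemma mcx_ok ds cs t : uniq (t :: ds ++ cs) -> all triple_ok (mcx ds cs t).
Proof.
move=> u; rewrite all_cat ladder_ok //.
case: ds cs u => [|d ds] [|c cs] // u; apply: ladder_ok.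
move: u => /= /andP[_]; rewrite !mem_cat inE !negb_or => /andP[/and3P[-> _ ->]].
by rewrite !cat_uniq /= negb_or => /and3P[-> /andP[_ ->] /andP[_ ->]].
Qed.

(* The borrowed qubit [q] is toggled by the first half of the controls, used as a
   control together with the second half, and the round is repeated so that the
   unknown initial value of [q] cancels. *)
Lemma mcx_borrowed (cs : seq 'I_n) (q t : 'I_n) :
  (2 < size cs)%N -> uniq [:: q, t & cs] ->
  exists s, [/\ all triple_ok s, (size s + 20 <= 8 * size cs)%N
    & forall x, run s x = flip (fun x => all x cs) t x].
Proof.
move=> sz u.
(* A nearly even split lets each half lend its qubits to the other: k1 controls borrow k1 - 2 qubits
   from the second half, and the k2 + 1 controls including [q] borrow k2 - 1 from the first. *)
have [k1 [k2 [h1 h2 h12 h3 h4]]] : exists k1 k2, [/\ (1 < k1)%N, (0 < k2)%N,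
    (k1 + k2 = size cs)%N, (k1 <= k2.+1)%N & (k2 <= k1)%N].
  by exists (size cs - (size cs)./2)%N, (size cs)./2; split; lia.
set cs1 := take k1 cs; set cs2 := drop k1 cs.
have s1 : size cs1 = k1 by rewrite size_takel; lia.
have s2 : size cs2 = k2 by rewrite size_drop; lia.
have ecs : cs = cs1 ++ cs2 by rewrite cat_take_drop.
set ds1 := take (k1 - 2) cs2; set ds2 := take (k2 - 1) cs1.
have sd1 : size ds1 = (k1 - 2)%N by rewrite size_takel; lia.
have sd2 : size ds2 = (k2 - 1)%N by rewrite size_takel; lia.
move: u; rewrite ecs /= !inE !mem_cat !negb_or => /and3P[/and3P[qt q1 q2] /andP[t1 t2]].
rewrite cat_uniq => /and3P[u1 h u2].
have sub1 : {subset ds1 <= cs2} by move=> j /mem_take.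
have sub2 : {subset ds2 <= cs1} by move=> j /mem_take.
have uA : uniq (q :: ds1 ++ cs1).
  rewrite /= mem_cat negb_or q1 (contra (@sub1 _) q2) cat_uniq u1 take_uniq //= andbT.
  apply/hasPn => j j1; apply/negP => /sub1 j2; by case/negP: h; apply/hasP; exists j.
have uB : uniq (t :: ds2 ++ q :: cs2).
  rewrite /= mem_cat inE !negb_or t2 (eq_sym t) qt (contra (@sub2 _) t1) cat_uniq /= negb_or.
  rewrite q2 u2 take_uniq //= (contra (@sub2 _) q1) /= andbT.
  apply/hasPn => j j2; apply/negP => /sub2 j1; by case/negP: h; apply/hasP; exists j.
have [A [okA sA rA]] : exists A, [/\ all triple_ok A, (size A <= (4 * (k1 - 2)).+1)%N
    & forall y, run A y = flip (fun x => all x cs1) q y].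
  have e1 : size cs1 = (size ds1).+2 by rewrite s1 sd1; case: (k1) h1 => [|[|k]] //= _; rewrite subn2.
  by exists (mcx ds1 cs1 q); split; [exact: mcx_ok|rewrite -sd1 size_mcx|move=> y; apply: run_mcx].
have [B [okB sB rB]] : exists B, [/\ all triple_ok B, (size B <= (4 * (k2 - 1)).+1)%N
    & forall y, run B y = flip (fun x => all x (q :: cs2)) t y].
  have e2 : size (q :: cs2) = (size ds2).+2 by rewrite /= s2 sd2 subn1 prednK.
  by exists (mcx ds2 (q :: cs2) t); split; [exact: mcx_ok|rewrite -sd2 size_mcx|move=> y; apply: run_mcx].
exists (A ++ B ++ A ++ B); split.
- by rewrite !all_cat okA okB.
(* The bound is 2 (4 (k1 - 2) + 1 + 4 (k2 - 1) + 1) = 8 (k1 + k2) - 20. *)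
- by move: h1 h2 sA sB; rewrite !size_cat s1 s2; clear; lia.
move=> x; rewrite !run_cat.
have fq (p : bits n -> bool) y cs' : q \notin cs' -> all (flip p q y) cs' = all y cs'.
  by move=> qn; apply: eq_in_all => j jc; rewrite flip_id //; apply: contraNneq qn => <-.
have ft (p : bits n -> bool) y cs' : t \notin cs' -> all (flip p t y) cs' = all y cs'.
  by move=> tn; apply: eq_in_all => j jc; rewrite flip_id //; apply: contraNneq tn => <-.
rewrite !rA !rB; apply/ffunP => k.
rewrite [LHS]ffunE ft // fq // ft //.
rewrite [flip _ t _ k]ffunE /= fq // ft //.
rewrite ![flip _ q _ _]ffunE ft //= ![flip _ t x _]ffunE /= all_cat eqxx (negPf qt) /=.
(* With c1, c2 the conjunctions of the halves, [t] receives q c2 and then (q + c1) c2 modulo 2,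
   whose sum is c1 c2; elsewhere the two toggles of [q] cancel. *)
rewrite addbF; case: (eqVneq k t) => [->|kt] /=.
  rewrite eq_sym (negPf qt) /= ?addbF.
  by case: (x t); case: (x q); case: (all x cs1); case: (all x cs2).
by rewrite ?addbF -addbA addbb addbF.
Qed.

End Toffoli.

(** * Splitting registers, and operators selected by the label register *)

Section Registers.
Variable C : numClosedFieldType.

Definition join_bits a b (u : bits a) (w : bits b) : bits (a + b) :=
  [ffun k => match split k with inl i => u i | inr j => w j end].

Lemma lbits_join a b (u : bits a) (w : bits b) : lbits (join_bits u w) = u.
Proof.
apply/ffunP => i; rewrite !ffunE; case: splitP => [j /= /val_inj -> //|j /= e].
by have := ltn_ord i; rewrite e ltnNge leq_addr.
Qed.

Lemma rbits_join a b (u : bits a) (w : bits b) : rbits (join_bits u w) = w.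
Proof.
apply/ffunP => i; rewrite !ffunE; case: splitP => j /= => [e|/addnI/val_inj -> //].
by have := ltn_ord j; rewrite -e ltnNge leq_addr.
Qed.

Lemma join_lrbits a b (x : bits (a + b)) : join_bits (lbits x) (rbits x) = x.
Proof.
by apply/ffunP => i; rewrite !ffunE; case: splitP => j e; rewrite ffunE; congr (x _); apply/val_inj.
Qed.

Lemma sum_bits_split a b (f : bits (a + b) -> C) :
  \sum_y f y = \sum_(u : bits a) \sum_(w : bits b) f (join_bits u w).
Proof.
rewrite pair_big /=.
rewrite (reindex (fun p : bits a * bits b => join_bits p.1 p.2)) //.
exists (fun x => (lbits x, rbits x)) => [[u w] _|x _] /=.
  by rewrite lbits_join rbits_join.
exact: join_lrbits.
Qed.

Lemma eq_bits_prod n (x y : bits n) : \prod_k (x k == y k)%:R = (x == y)%:R :> C.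
Proof.
rewrite prodb; congr (nat_of_bool _)%:R.
by apply/forallP/eqP => [e|-> k]; [apply/ffunP => k; exact/eqP/e|rewrite eqxx].
Qed.

Definition rset a b : {set 'I_(a + b)} := [set rshift a k | k : 'I_b].

Lemma lshift_rset a b (i : 'I_a) : (lshift b i \in rset a b) = false.
Proof. by apply/imsetP => -[k _ /eqP]; rewrite eq_lrshift. Qed.

Lemma rshift_rset a b (k : 'I_b) : rshift a k \in rset a b.
Proof. exact: imset_f. Qed.

(** This is the sum over labels [l] of |l><l| tensored with the [m]-th tensor power of [F l].
    Written through [loc], such operators multiply pointwise in [l]. *)
Definition select_op r m (F : bits r -> 'M[C]_2) : qop C (r + m) :=
  loc (rset r m) (fun x => F (lbits x)).

Lemma entry_select_op r m (F : bits r -> 'M[C]_2) (x y : bits (r + m)) :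
  entry (select_op m F) x y
  = (lbits x == lbits y)%:R * entry (tpow_op m (F (lbits x))) (rbits x) (rbits y).
Proof.
rewrite !entry_mkop big_split_ord /= -eq_bits_prod; congr (_ * _).
  by apply: eq_bigr => i _; rewrite lshift_rset one_bit !ffunE.
by apply: eq_bigr => i _; rewrite rshift_rset !ffunE.
Qed.

Lemma indep_lbits r m (T : Type) (F : bits r -> T) :
  indep (rset r m) (fun x => F (lbits x)).
Proof.
move=> x y e; congr F; apply/ffunP => i; rewrite !ffunE e //.
by rewrite lshift_rset.
Qed.

Lemma select_opM r m (F F' : bits r -> 'M[C]_2) :
  select_op m F *m select_op m F' = select_op m (fun l => F l *m F' l).
Proof. by apply: locM; apply: indep_lbits. Qed.

Lemma select_op_unitary r m (F : bits r -> 'M[C]_2) :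
  (forall l, F l \is unitarymx) -> select_op m F \is unitarymx.
Proof. by move=> uF; apply: loc_unitary => //; apply: indep_lbits. Qed.

Lemma eq_select_op r m (F F' : bits r -> 'M[C]_2) :
  F =1 F' -> select_op m F = select_op m F'.
Proof. by move=> e; apply: eq_loc => x; rewrite e. Qed.

(** The operator is block diagonal in the label, and every label has the same amplitude in the
    product of plus states. *)
Lemma select_op_plus r m (F : bits r -> 'M[C]_2) (phi : qstate C m) :
  select_op m F *m tens_state (tpow_state r (plus_state C)) phi
  = (sqrtC (2 ^ r)%:R)^-1 *: \sum_l tens_state (ket C l) (tpow_op m (F l) *m phi).
Proof.
apply: stateP => x; rewrite ampM sum_bits_split.
rewrite (bigD1 (lbits x)) //= [X in _ + X]big1 ?addr0; last first.
  move=> u /negPf ne; rewrite big1 // => w _.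
  by rewrite entry_select_op lbits_join eq_sym ne !mul0r.
have ampZ c (v : qstate C (r + m)) : amp (c *: v) x = c * amp v x by rewrite /amp mxE.
have amp_sum (f : bits r -> qstate C (r + m)) : amp (\sum_l f l) x = \sum_l amp (f l) x.
  by rewrite /amp summxE.
rewrite ampZ amp_sum (bigD1 (lbits x)) //= [X in _ + X]big1 ?addr0; last first.
  by move=> u /negPf ne; rewrite amp_mkstate amp_mkstate eq_sym ne mul0r.
rewrite amp_mkstate amp_mkstate eqxx mul1r ampM mulr_sumr; apply: eq_bigr => w _.
rewrite entry_select_op !amp_mkstate lbits_join rbits_join eqxx mul1r mulrCA; congr (_ * _).
rewrite natrX rootCX ?ler0n // -exprVn -[X in _ ^+ X]card_ord -prodr_const.
apply: eq_bigr => k _.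
by rewrite !mxE; case: (lbits x k); rewrite /= ?addr0 ?add0r mulr1.
Qed.

End Registers.

(** * Sequential circuits, their cost and their operators *)

Section Steps.
Variables (C : numClosedFieldType) (n : nat).

Definition steps (gs : seq (gate C n)) : circuit C n := [seq [:: g] | g <- gs].

Lemma flatten_steps gs : flatten (steps gs) = gs.
Proof. by elim: gs => //= g gs ->. Qed.

Lemma size_steps gs : size (steps gs) = size gs.
Proof. exact: size_map. Qed.

Lemma gate_count_cat (c1 c2 : circuit C n) :
  gate_count (c1 ++ c2) = (gate_count c1 + gate_count c2)%N.
Proof. by rewrite /gate_count map_cat sumn_cat. Qed.

Lemma gate_count_steps gs : gate_count (steps gs) = size gs.
Proof. by elim: gs => //= g gs; rewrite /gate_count /= => ->. Qed.

Lemma circuit_op_cat (c1 c2 : circuit C n) :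
  circuit_op (c1 ++ c2) = circuit_op c2 *m circuit_op c1.
Proof. by rewrite /circuit_op flatten_cat -!/(gates_op _) gates_op_cat. Qed.

Lemma circuit_op_steps gs : circuit_op (steps gs) = gates_op gs.
Proof. by rewrite /circuit_op flatten_steps. Qed.

Lemma circuit_op_step (s : seq (gate C n)) : circuit_op [:: s] = gates_op s.
Proof. by rewrite /circuit_op /= cats0. Qed.

Lemma gates_op_map (f : 'I_n -> gate C n) (A : bits n -> 'M[C]_2) ts :
    uniq ts -> indep [set:: ts] A -> {in ts, forall t, gate_op (f t) = loc [set t] A} ->
  gates_op (map f ts) = loc [set:: ts] A.
Proof.
elim: ts => [_ _ _|t ts IH] /=.
  by rewrite -[LHS](loc1 C (set0 : {set 'I_n})); apply: eq_local_op => x k; rewrite !inE.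
move=> /andP[tts uts] iA fA; rewrite gates_op_cons fA ?mem_head //.
have sub : [set:: t :: ts] = [set:: ts] :|: [set t].
  by apply/setP => k; rewrite !inE orbC.
rewrite IH // ?sub; first last.
- by move=> k kts; apply: fA; rewrite inE kts orbT.
- by move=> x y e; apply: iA => k; rewrite !inE negb_or => /andP[_ kts]; apply: e; rewrite inE.
apply: locU; last by rewrite -sub.
by rewrite disjoint_sym disjoints1 inE.
Qed.

End Steps.

(** * Circuits for one conditional application of a group element to all targets *)

Section Blocks.
Variables (C : numClosedFieldType) (gT : finGroupType) (G : {group gT}).
Variables (U : gT -> 'M[C]_2) (r m : nat).
Hypothesis U_unitary : forall g, g \in G -> U g \is unitarymx.
Hypothesis m_gt0 : (0 < m)%N.

Local Notation N := (r + m + 1)%N.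
Local Notation tgt := (@target_qubit r m).
Local Notation valid := (@valid_circuit C N gT G U m tgt).

Definition label_qubit (i : 'I_r) : 'I_N := lshift 1 (lshift m i).
Definition aux_qubit : 'I_N := rshift (r + m) (0 : 'I_1).
Definition targets : {set 'I_N} := [set lshift 1 j | j in rset r m].

Lemma lshift_targets j : (lshift 1 j \in targets) = (j \in rset r m).
Proof. exact/mem_imset/lshift_inj. Qed.

Lemma aux_targets : aux_qubit \notin targets.
Proof. by apply/imsetP => -[k _ /eqP]; rewrite eq_rlshift. Qed.

Lemma label_targets i : label_qubit i \notin targets.
Proof. by rewrite lshift_targets lshift_rset. Qed.

Lemma tgt_targets k : tgt k \in targets.
Proof. by rewrite lshift_targets rshift_rset. Qed.

Lemma tgt_inj : injective tgt.
Proof. by move=> i j /lshift_inj /rshift_inj. Qed.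

Lemma targetsE : targets = [set:: map tgt (enum 'I_m)].
Proof.
apply/setP => k; rewrite inE; apply/imsetP/mapP.
  by case=> _ /imsetP[j _ ->] ->; exists j; rewrite ?mem_enum.
by case=> j _ ->; exists (rshift r j); rewrite ?rshift_rset.
Qed.

Lemma valid_cat (c1 c2 : circuit C N) : valid c1 -> valid c2 -> valid (c1 ++ c2).
Proof.
move=> v1 v2 i; rewrite size_cat nth_cat; case: (ltnP i (size c1)) => [lt _|le lt]; first exact: v1.
by apply: v2; rewrite -(ltn_add2l (size c1)) subnKC.
Qed.

Lemma valid_step s : time_step G U tgt s -> valid [:: s].
Proof. by move=> ts [|]. Qed.

Lemma valid_steps gs : all (@elementary C N) gs -> valid (steps gs).
Proof.
elim: gs => [_ i //|g gs IH /= /andP[eg egs]].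
rewrite -cat1s; apply: valid_cat (IH egs); apply: valid_step.
by split; rewrite /= ?eg //; left.
Qed.

Definition ctrl_step g c : seq (gate C N) := [seq ctrl_gate (U g) c (tgt k) | k <- enum 'I_m].
Definition single_step g : seq (gate C N) := [seq single_gate (U g) (tgt k) | k <- enum 'I_m].

Lemma size_ctrl_step g c : size (ctrl_step g c) = m.
Proof. by rewrite size_map size_enum_ord. Qed.

Lemma size_single_step g : size (single_step g) = m.
Proof. by rewrite size_map size_enum_ord. Qed.

Lemma valid_ctrl_step g c : g \in G -> c \notin targets -> valid [:: ctrl_step g c].
Proof.
move=> gG cT; apply: valid_step; split; first by rewrite size_ctrl_step.
  rewrite all_map; apply/allP => k _ /=; apply: elementary_ctrl; first exact: U_unitary.
  by apply: contraNneq cT => ->; apply: tgt_targets.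
by right; exists g, c.
Qed.

Lemma valid_single_step g : g \in G -> valid [:: single_step g].
Proof.
move=> gG; apply: valid_step; split; first by rewrite size_single_step.
  by rewrite all_map; apply/allP => k _ /=; apply/elementary_single/U_unitary.
left; rewrite pairwise_map; have := enum_uniq 'I_m; rewrite uniq_pairwise.
apply: sub_pairwise => i j ij; apply/pred0P => k /=; rewrite !(codom_single (U g)).
by case: eqP => //= ->; rewrite (inj_eq tgt_inj) (negPf ij).
Qed.

Lemma ctrl_step_op g c : c \notin targets ->
  gates_op (ctrl_step g c) = loc targets (fun x => if x c then U g else 1%:M).
Proof.
move=> cT; rewrite /ctrl_step (map_comp (fun t => ctrl_gate (U g) c t) tgt) targetsE.
apply: gates_op_map; first by rewrite (map_inj_uniq tgt_inj) enum_uniq.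
  by move=> x y e; rewrite e // -targetsE.
move=> t /mapP[k _ ->]; apply: gate_op_ctrl.
by apply: contraNneq cT => ->; apply: tgt_targets.
Qed.

Lemma single_step_op g : gates_op (single_step g) = loc targets (fun=> U g).
Proof.
rewrite /single_step (map_comp (fun t => single_gate (U g) t) tgt) targetsE.
apply: gates_op_map => //; first by rewrite (map_inj_uniq tgt_inj) enum_uniq.
by move=> t _; apply: gate_op_single.
Qed.

Lemma entry_loc_targets (A : bits N -> 'M[C]_2) (x y : bits N) :
  entry (loc targets A) x y = entry (select_op m (fun=> A x)) (lbits x) (lbits y)
    * (rbits x == rbits y)%:R.
Proof.
rewrite !entry_mkop big_split_ord /= -eq_bits_prod; congr (_ * _).
  by apply: eq_bigr => i _; rewrite lshift_targets !ffunE.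
apply: eq_bigr => i _; rewrite (ord1 i) (negPf aux_targets) one_bit !ffunE //.
Qed.

(** An operator local to the targets leaves the auxiliary qubit alone, so on inputs with that qubit
    at 0 only the values of [A] at such labels are seen. *)
Lemma implements_loc (c : circuit C N) (A : bits N -> 'M[C]_2) (F : bits r -> 'M[C]_2) :
    circuit_op c = loc targets A ->
    (forall x : bits N, x aux_qubit = false -> A x = F (lbits (lbits x))) ->
  implements c (select_op m F).
Proof.
move=> cA AF psi; rewrite cA; apply: stateP => x.
rewrite ampM amp_mkstate amp_mkstate ampM sum_bits_split mulr_suml.
apply: eq_bigr => u _.
rewrite (bigD1 [ffun=> false]) //= [X in _ + X]big1 ?addr0; last first.
  by move=> w /negPf ne; rewrite !amp_mkstate rbits_join ne !mulr0.
rewrite entry_loc_targets !amp_mkstate lbits_join rbits_join eqxx mulr1 mulrAC.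
case: eqP => [e|_]; rewrite ?mulr0 // !mulr1 !entry_select_op AF //.
by have /ffunP/(_ 0) := e; rewrite !ffunE.
Qed.

Lemma implements_cat (c1 c2 : circuit C N) W1 W2 :
  implements c1 W1 -> implements c2 W2 -> implements (c1 ++ c2) (W2 *m W1).
Proof. by move=> i1 i2 psi; rewrite circuit_op_cat -mulmxA i1 i2 mulmxA. Qed.

Lemma label_aux i : label_qubit i != aux_qubit.
Proof. by rewrite eq_lrshift. Qed.

Lemma label_inj : injective label_qubit.
Proof. by move=> i j /lshift_inj /lshift_inj. Qed.

Definition above (T l : bits r) := [forall i, T i ==> l i].
Definition ones (T : bits r) := [seq i <- enum 'I_r | T i].

Lemma all_ones T (x : bits N) :
  all x (map label_qubit (ones T)) = above T (lbits (lbits x)).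
Proof.
rewrite all_map; apply/allP/forallP => e i.
  by apply/implyP => Ti; have := e i; rewrite mem_filter Ti mem_enum /= !ffunE; apply.
by rewrite mem_filter => /andP[Ti _]; have := e i; rewrite Ti !ffunE.
Qed.

(** Computing and erasing the conjunction on the auxiliary qubit adds it to the control of the
    middle step. When that qubit starts at 0, the control is exactly the condition T <= l. *)
Lemma ctrl_step_conj g T :
  let s := pull C (flip (fun x : bits N => all x (map label_qubit (ones T))) aux_qubit) in
  s *m gates_op (ctrl_step g aux_qubit) *m s
  = loc targets (fun x => if x aux_qubit (+) above T (lbits (lbits x)) then U g else 1%:M).
Proof.
rewrite /= ctrl_step_op ?aux_targets // loc_conj; first last.
- move=> x y e k kT; rewrite !ffunE e //; congr (_ (+) (_ && _)).
  by apply: eq_in_all => _ /mapP[i _ ->]; apply/e/label_targets.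
- move=> x k kT; rewrite flip_id //; apply: contraTneq kT => ->; exact: aux_targets.
- apply: flipK => x y e; apply: eq_in_all => _ /mapP[i _ ->]; apply: e.
  by rewrite inE label_aux.
by apply: eq_loc => x /=; rewrite ffunE eqxx all_ones.
Qed.

(* For k >= 3: two passes, at most 8k - 20 Toffoli gates per pass, 5 gates per Toffoli. *)
Definition block_cost k := match k with 0 | 1 => 0 | 2 => 8 | _ => 80 * k - 200 end%N.

Definition block_op h T : qop C (r + m) :=
  select_op m (fun l => if above T l then U h else 1%:M).

(** [K] counts the gates outside the one parallel step on the targets. Each takes a time step of its
    own, hence the same [K] enters gate count and depth. *)
Lemma block_circuit h T : h \in G -> exists c K,
  [/\ valid c, implements c (block_op h T), gate_count c = (K + m)%N,
      logical_depth c = (K + 1)%N & (K <= block_cost (size (ones T)))%N].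
Proof.
move=> hG; have hU := all_ones T; have cj := ctrl_step_conj h T.
(* The common shape for weight at least 2: compute the condition, apply the controlled step, erase
   the condition. *)
have sandwich gs1 gs2 : all (@elementary C N) gs1 -> all (@elementary C N) gs2 ->
    gates_op gs2 *m gates_op (ctrl_step h aux_qubit) *m gates_op gs1
    = loc targets (fun x => if x aux_qubit (+) above T (lbits (lbits x)) then U h else 1%:M) ->
  let c := steps gs1 ++ [:: ctrl_step h aux_qubit] ++ steps gs2 in
  [/\ valid c, implements c (block_op h T), gate_count c = (size gs1 + size gs2 + m)%N
    & logical_depth c = (size gs1 + size gs2 + 1)%N].
  move=> e1 e2 e /=; split.
  - apply: valid_cat; first exact: valid_steps.
    rewrite -cat1s; apply: valid_cat; last exact: valid_steps.
    by apply: valid_ctrl_step hG aux_targets.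
  - apply: implements_loc (_ : _ = loc targets _) _.
      by rewrite circuit_op_cat -cat1s circuit_op_cat !circuit_op_steps circuit_op_step; exact: e.
    by move=> x /= ->.
  - rewrite gate_count_cat -cat1s gate_count_cat !gate_count_steps /gate_count /= size_ctrl_step.
    by rewrite addn0 addnA addnAC.
  - by rewrite /logical_depth size_cat /= !size_steps addnS [RHS]addn1.
have uo : uniq (map label_qubit (ones T)).
  by rewrite (map_inj_uniq label_inj) filter_uniq ?enum_uniq.
have oaux : aux_qubit \notin map label_qubit (ones T).
  by apply/mapP => -[i _ e]; have := label_aux i; rewrite -e eqxx.
case eo : (ones T) => [|i [|j [|k js]]].
- exists [:: single_step h], 0%N; split => //; first exact: valid_single_step.
    apply: implements_loc; first by rewrite circuit_op_step single_step_op.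
    by move=> x _; rewrite -hU eo.
  by rewrite /gate_count /= size_single_step addn0.
- exists [:: ctrl_step h (label_qubit i)], 0%N; split => //.
  + by apply: valid_ctrl_step; last exact: label_targets.
  + apply: implements_loc; first by rewrite circuit_op_step ctrl_step_op ?label_targets.
    by move=> x _; rewrite -hU eo /= andbT.
  + by rewrite /gate_count /= size_ctrl_step addn0.
- have ok : triple_ok (label_qubit i, label_qubit j, aux_qubit).
    move: uo; rewrite eo /= !label_aux !andbT inE => -> //.
  (* The CNOT that completes each Toffoli commutes with the controlled step. *)
  have [|v im gc ld] := sandwich (toffoli_head C (label_qubit i) (label_qubit j) aux_qubit)
      (toffoli_tail C (label_qubit i) (label_qubit j) aux_qubit)
      (elementary_toffoli_head _ ok) (elementary_toffoli_tail _ ok); last first.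
    by eexists; exists 8%N; split; [exact: v|exact: im|exact: gc|exact: ld|].
  rewrite -cj eo.
  have fe : flip (fun x : bits N => all x (map label_qubit [:: i; j])) aux_qubit
      =1 flip (fun x => x (label_qubit i) && x (label_qubit j)) aux_qubit.
    by move=> x; apply/ffunP => k; rewrite !ffunE /= andbT.
  rewrite (eq_pull C fe) -{1}(gates_op_toffoli_rev C ok) -(gates_op_toffoli C ok).
  rewrite gates_op_cons [gates_op (toffoli _ _ _ _)]gates_op_cat gates_op1.
  have cu : gates_op (ctrl_step h aux_qubit)
      = gate_op (cnot C (label_qubit i) (label_qubit j)) *m gates_op (ctrl_step h aux_qubit)
        *m gate_op (cnot C (label_qubit i) (label_qubit j)).
    case/and3P: ok => ij _ _.
    rewrite gate_op_cnot // ctrl_step_op ?aux_targets // loc_conj.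
    + by apply: eq_loc => x /=; rewrite flip_id // eq_sym label_aux.
    + by apply: flipK => x y; apply; rewrite inE.
    + move=> x k kT; rewrite flip_id //; apply: contraTneq kT => ->; exact: label_targets.
    + by move=> x y e k kT; rewrite !ffunE !e // label_targets.
  by rewrite [in LHS]cu !mulmxA.
have sz : size (map label_qubit (ones T)) = (size js).+3 by rewrite size_map eo.
(* The first target exists because [m] is positive. It may be borrowed although its state is
   arbitrary, since each pass restores it before the controlled step acts. *)
have qT := tgt_targets (Ordinal m_gt0).
have [||s [oks ss rs]] := @mcx_borrowed N (map label_qubit (ones T)) (tgt (Ordinal m_gt0)) aux_qubit.
- by rewrite sz.
- rewrite /= inE uo oaux negb_or !andbT; apply/andP; split.
    by rewrite eq_lrshift.
  by apply/mapP => -[l _ e]; have := label_targets l; rewrite -e qT.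
have en := elementary_net C oks.
have [|v im gc ld] := sandwich _ _ en en; last first.
  eexists; exists (size (net C s) + size (net C s))%N; split; [exact: v|exact: im|exact: gc|exact: ld|].
  by rewrite size_net /block_cost /=; move: ss; rewrite sz; move: (size s) (size js); lia.
by rewrite -cj (gates_op_net C oks) (eq_pull C rs).
Qed.

End Blocks.

(** * Total cost of the blocks over the Boolean lattice *)

Section Counting.
Variable r : nat.

Local Notation weight T := (size (@ones r T)).

Lemma weight_card (T : bits r) : weight T = #|[set i | T i]|.
Proof.
rewrite cardsE cardE /ones /enum_mem -filter_predI; congr size.
by apply: eq_filter => i; rewrite /= andbT.
Qed.

Lemma weight_le (T : bits r) : (weight T <= r)%N.
Proof. by rewrite weight_card; have := max_card [set i | T i]; rewrite card_ord. Qed.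

Lemma weight_compl (T : bits r) : weight [ffun i => ~~ T i] = (r - weight T)%N.
Proof.
rewrite !weight_card cardsCs card_ord; congr (_ - #|pred_of_set _|)%N.
by apply/setP => i; rewrite !inE ffunE negbK.
Qed.

(** Ensures that listing the strings by increasing weight gives a linear extension of the Boolean
    lattice. *)
Lemma above_weight (l T : bits r) : above T l -> (weight l <= weight T)%N -> l = T.
Proof.
rewrite !weight_card => /forallP Tl lT.
have /eqP e : [set i | T i] == [set i | l i].
  by rewrite eqEcard lT andbT; apply/subsetP => i; rewrite !inE => Ti; have := Tl i; rewrite Ti.
by apply/ffunP => i; have := in_set T i; rewrite e inE.
Qed.

Lemma card_bits : #|{: bits r}| = (2 ^ r)%N.
Proof. by rewrite card_ffun card_bool card_ord. Qed.

(** With r = i + j the right side is 2 (41 r - 80). A single string of large weight can exceed 41 r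
    - 80, so the budget is only met on average over complementary pairs. *)
Lemma block_cost_compl i j : (2 < i + j)%N ->
  (block_cost i + block_cost j <= 82 * (i + j) - 160)%N.
Proof.
rewrite /block_cost.
by case: i => [|[|[|i]]]; case: j => [|[|[|j]]]; lia.
Qed.

Lemma sum_block_cost : (1 < r)%N ->
  (\sum_(T : bits r) block_cost (weight T) <= 2 ^ r * (41 * r - 80))%N.
Proof.
move=> r1; have [r2|r2] := ltnP 2 r.
  set S := (\sum_T _)%N.
  suff : (2 * S <= 2 ^ r * (82 * r - 160))%N by move: (2 ^ r)%N S; clear; nia.
  (* Complementation permutes the strings, so twice the sum can be bounded pair by pair. *)
  have eS : S = (\sum_(T : bits r) block_cost (r - weight T))%N.
    rewrite /S (reindex_inj (h := fun T : bits r => [ffun i => ~~ T i] : bits r)).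
      by apply: eq_bigr => T _; rewrite weight_compl.
    by move=> x y /ffunP e; apply/ffunP => i; have := e i; rewrite !ffunE => /negb_inj.
  rewrite mul2n -addnn {2}eS -big_split /= -card_bits -sum_nat_const.
  apply: leq_sum => T _; have := @block_cost_compl (weight T) (r - weight T).
  by rewrite subnKC ?weight_le //; apply.
(* Pairing fails here: weights 0 and 2 cost 8 together against 4 allowed. The whole budget 4 (82 -
   80) = 8 is what the full string costs, and all others are free. *)
have er : r = 2%N by lia.
rewrite (bigD1 [ffun=> true]) //= big1 => [|T nT].
  rewrite addn0; have : (weight [ffun=> true] <= 2)%N by rewrite -er weight_le.
  by move: (weight _) => w; rewrite er; case: w => [|[|[|]]].
have : (weight T < 2)%N.
  rewrite ltnNge; apply: contra nT => le; apply/eqP; symmetry.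
  apply: above_weight; first by apply/forallP => i; rewrite ffunE implybT.
  by apply: leq_trans le; rewrite -er weight_le.
by case: (weight T) => [|[|]].
Qed.

End Counting.

(** * Composing the blocks into a prescribed map from labels to group elements *)

Section Synthesis.
Variables (C : numClosedFieldType) (gT : finGroupType) (G : {group gT}).
Variables (U : mx_representation C G 2) (r m : nat).

Local Notation N := (r + m + 1)%N.
Local Notation tgt := (@target_qubit r m).
Local Notation valid := (@valid_circuit C N gT G U m tgt).
Local Notation weight T := (size (ones T)).

(* Noncommutative Moebius inversion: the block at [T] fixes the value at [T] and
   does not disturb the labels already treated, none of which lies above [T]. *)
Lemma select_circuit (tg : bits r -> gT) (s : seq (bits r)) :
    (forall g, g \in G -> U g \is unitarymx) -> (0 < m)%N ->
    (forall l, tg l \in G) -> uniq s -> pairwise (fun l T => ~~ above T l) s ->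
  exists c K f, [/\ valid c /\ implements c (select_op m (fun l => U (f l))),
    gate_count c = (K + m * size s)%N, logical_depth c = (K + size s)%N,
    (K <= \sum_(T <- s) block_cost (weight T))%N
    & (forall l, f l \in G) /\ {in s, f =1 tg}].
Proof.
move=> U_unitary m_gt0 tgG; elim/last_ind: s => [_ _|s T IH].
  exists [::], 0%N, (fun=> 1%g); split => //; last first.
  - by rewrite muln0.
  split=> // psi; rewrite /circuit_op /= mul1mx.
  rewrite (@eq_select_op _ r m _ (fun=> 1%:M)) => [|l]; last exact: repr_mx1.
  by rewrite /select_op loc1 mul1mx.
rewrite rcons_uniq pairwise_rcons => /andP[Ts us] /andP[/allP aT ps].
have [c [K [f [[v im] gc ld cK [fG ftg]]]]] := IH us ps.
(* The left factor that corrects the value accumulated so far at [T] to the prescribed one. *)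
pose h := (tg T * (f T)^-1)%g.
have hG : h \in G by rewrite groupM ?groupV.
have [c' [K' [v' im' gc' ld' cK']]] := block_circuit U_unitary m_gt0 T hG.
exists (c ++ c'), (K + K')%N, (fun l => if above T l then h * f l else f l)%g; split.
- split; first exact: valid_cat.
  have -> : select_op m (fun l => U (if above T l then h * f l else f l)%g)
      = block_op U m h T *m select_op m (fun l => U (f l)).
    rewrite select_opM; apply: eq_select_op => l.
    by case: ifP => _; rewrite ?mul1mx // repr_mxM.
  exact: implements_cat.
- by rewrite gate_count_cat gc gc' size_rcons mulnS; lia.
- by move: ld ld'; rewrite /logical_depth size_cat size_rcons => -> ->; lia.
- by rewrite -cats1 big_cat big_seq1 leq_add.
split=> l; first by case: ifP => _ /=; [apply: groupM|].
rewrite mem_rcons inE => /orP[/eqP ->|ls]; last by rewrite (negPf (aT l ls)) ftg.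
have -> : above T T by apply/forallP => i; rewrite implybb.
by rewrite /h mulgKV.
Qed.

End Synthesis.

(** * Inverting the labelling, and the final circuit with its exact cost *)

Lemma group_op_select (C : numClosedFieldType) (gT : finGroupType) (G : {group gT})
    (U : gT -> 'M[C]_2) (r m : nat) (label : gT -> bits r) (tg : bits r -> gT) :
    {in G &, injective label} -> (forall l, tg l \in G /\ label (tg l) = l) ->
  group_op G U m label = select_op m (fun l => U (tg l)).
Proof.
move=> linj tgP; apply: opP => x y; rewrite entry_select_op.
have entry_sum (f : gT -> qop C (r + m)) :
    entry (\sum_(g in G) f g) x y = \sum_(g in G) entry (f g) x y.
  by rewrite /entry summxE.
have [tG tl] := tgP (lbits x).
rewrite entry_sum (bigD1 (tg (lbits x))) //= [X in _ + X]big1 ?addr0; last first.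
  move=> g /andP[gG ne]; rewrite entry_mkop entry_ketbra.
  case: eqP => [e|_]; last by rewrite !mul0r.
  by case/eqP: ne; apply: linj; rewrite // tl.
by rewrite entry_mkop entry_ketbra tl eqxx mul1r eq_sym.
Qed.

Lemma label_inverse (gT : finGroupType) (G : {group gT}) (r : nat) (label : gT -> bits r) :
    #|G| = (2 ^ r)%N -> {in G &, injective label} ->
  (* An injection of [G] into a set of the same size hits every label, so the default [1%g] used in
     the witness is never reached. *)
  exists tg : bits r -> gT, forall l, tg l \in G /\ label (tg l) = l.
Proof.
move=> cG linj; exists (fun l => odflt 1%g [pick g in G | label g == l]) => l.
case: pickP => [g /andP[gG /eqP gl] //|none].
have : label @: G == [set: bits r].
  by rewrite eqEcard subsetT cardsT card_bits (card_in_imset linj) cG leqnn.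
move/eqP/setP/(_ l); rewrite inE => /imsetP[g gG e].
by have := none g; rewrite gG e eqxx.
Qed.

Theorem mainTheorem4 (R : realType) :
  (forall (r : nat) (gT : finGroupType) (G : {group gT})
     (U : mx_representation R[i] G 2) (label : gT -> bits r) (m : nat),
     (1 < r)%N ->
     #|G| = (2 ^ r)%N ->
     (forall g, g \in G -> U g \is unitarymx) ->
     {in G &, injective label} ->
     (0 < m)%N ->
     let W := group_op G U m label in
     [/\ W \is unitarymx,
         forall phi : qstate R[i] m,
           W *m tens_state (tpow_state r (plus_state R[i])) phi
           = (sqrtC #|G|%:R)^-1 *:
             (\sum_(g in G) tens_state (ket R[i] (label g)) (tpow_op m (U g) *m phi))
       & exists c : circuit R[i] (r + m + 1),
           [/\ valid_circuit G U (@target_qubit r m) c,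
               implements c W,
               gate_count c = (#|G| * (41 * r - 80 + m))%N
             & logical_depth c = (#|G| * (41 * r - 80 + 1))%N]])
  /\ (forall r : nat, (1 < r)%N ->
       exists a b : nat, (0 < a)%N /\
         forall m, (2 ^ r * (41 * r - 80 + m) = a * m + b)%N)
  /\ (forall m : nat, (0 < m)%N ->
       exists c1 c2 : nat, (0 < c1)%N /\
         forall r, (1 < r)%N ->
           (c1 * (2 ^ r * trunc_log 2 (2 ^ r)) <= 2 ^ r * (41 * r - 80 + m)
            <= c2 * (2 ^ r * trunc_log 2 (2 ^ r)))%N).
Proof.
split; last split.
- move=> r gT G U label m r1 cG uU linj m0 W.
  have [tg tgP] := label_inverse cG linj.
  have tgG l : tg l \in G by case: (tgP l).
  have WE : W = select_op m (fun l => U (tg l)) by exact: group_op_select.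
  have tgl l : label (tg l) = l by case: (tgP l).
  split; first by rewrite WE; apply: select_op_unitary => l; exact: uU.
    move=> phi; rewrite WE select_op_plus -cG; congr (_ *: _).
    have labelK : {in G, cancel label tg} by move=> g gG; apply: linj; rewrite ?tgl.
    rewrite (reindex_onto label tg) => [|l _]; last exact: tgl.
    apply: eq_big => [g|g /eqP ->] //.
    by apply/eqP/idP => [<- //|]; exact: labelK.
  have r0 : (0 < r)%N by exact: ltn_trans r1.
  pose wt (T : bits r) := size (ones T).
  pose le := fun T T' => (wt T <= wt T')%N.
  (* Treating strings by increasing weight guarantees that no string lies above a later one. *)
  pose s := sort le (enum {: bits r}).
  have us : uniq s by rewrite sort_uniq enum_uniq.
  have ps : pairwise (fun l T => ~~ above T l) s.
    have : pairwise le s.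
      rewrite -sorted_pairwise; last by move=> ? ? ?; apply: leq_trans.
      by apply: sort_sorted => ? ?; apply: leq_total.
    have /[swap] := us; rewrite uniq_pairwise => p1 p2.
    have : pairwise [rel l T | (l != T) && le l T] s by rewrite pairwise_relI p1 p2.
    apply: sub_pairwise => l T /andP[ne lT]; apply: contra ne => aT.
    by apply/eqP; exact: above_weight.
  have mem_s l : l \in s by rewrite mem_sort mem_enum.
  have ss : size s = (2 ^ r)%N by rewrite size_sort -cardE card_bits.
  have [c [K [f [[v im] gc ld cK [fG ftg]]]]] := select_circuit (U := U) uU m0 tgG us ps.
  have cK' : (K <= 2 ^ r * (41 * r - 80))%N.
    apply: leq_trans cK _; rewrite (perm_big _ (permEl (perm_sort _ _))) /= big_enum.
    exact: sum_block_cost.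
  (* An identity gate written as an elementary two-qubit gate. Used one per time step, it raises
     gate count and depth equally, so the single slack [p] makes both exact. *)
  pose pad : gate R[i] (r + m + 1) :=
    ctrl_gate 1%:M (aux_qubit r m) (label_qubit m (Ordinal r0)).
  have epad : elementary pad.
    apply: elementary_ctrl; last by rewrite eq_sym label_aux.
    by apply/unitarymxP; rewrite tr_scalar_mx map_scalar_mx rmorph1 mulmx1.
  have opad p : gates_op (nseq p pad) = 1%:M.
    elim: p => //= p IH; rewrite gates_op_cons IH mul1mx gate_op_ctrl 1?eq_sym ?label_aux //.
    by rewrite -[RHS](loc1 _ [set label_qubit m (Ordinal r0)]); apply: eq_loc => x; rewrite if_same.
  pose p := (2 ^ r * (41 * r - 80) - K)%N.
  exists (c ++ steps (nseq p pad)); split.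
  + by apply: valid_cat => //; apply: valid_steps; rewrite all_nseq epad orbT.
  + move=> psi; rewrite circuit_op_cat circuit_op_steps opad mul1mx im WE.
    by congr (tens_state (_ *m _) _); apply: eq_select_op => l; rewrite ftg.
  + rewrite gate_count_cat gate_count_steps gc size_nseq ss cG mulnDr [(m * _)%N]mulnC.
    by rewrite addnAC subnKC.
  + move: ld; rewrite /logical_depth size_cat size_steps size_nseq ss cG mulnDr muln1 => ->.
    by rewrite addnAC subnKC.
- move=> r r1; exists (2 ^ r)%N, (2 ^ r * (41 * r - 80))%N; rewrite expn_gt0; split=> // m.
  by rewrite mulnDr addnC.
(* The logarithm equals r. The lower bound r <= 41 r - 80 + m needs 80 <= 40 r + m, which holds from
   r = 2 on; the upper one is 41 r - 80 + m <= (41 + m) r. *)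
move=> m m0; exists 1%N, (41 + m)%N; split=> // r r1.
rewrite trunc_expnK // mul1n mulnCA !leq_mul2l.
by apply/andP; split; apply/orP; right; nia.
Qed.
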